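(* Let $X$ be a metric space and $F\subseteq X$ a closed subset. Then every little Lipschitz function $f:F\to\mathbb R$ has an extension $f^*:X\to\mathbb R$ such that $f^*$ is little Lipschitz on $F$ (i.e. $\operatorname{lip} f^*(x)<\infty$ for every $x\in F$) and $f^*$ is locally Lipschitz on $X\setminus F$. In particular, $f^*$ is little Lipschitz on $X$.
   Context: All spaces are separable metric spaces. $B(x,r)$ denotes the closed ball with center $x$ and radius $r>0$. For a mapping $f:X\to Y$ between metric spaces and $x\in X$ the lower scaled oscillation of $f$ at $x$ is $$\operatorname{lip} f(x)=\liminf_{r\to0}\frac{\operatorname{diam} f(B(x,r))}{r},$$ where $r\to 0$ through positive values and the ball is taken in the domain of the mapping. The mapping $f$ is little Lipschitz if $\operatorname{lip} f(x)<\infty$ for every $x$ in its domain. (For $f:F\to\mathbb R$ the balls are taken in the metric space $F$; for $f^*$ they are taken in $X$.) *)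

(* Defs.v *)
From HB Require Import structures.
From mathcomp Require Import all_boot all_order all_algebra.
From mathcomp Require Import all_classical all_reals all_analysis.

Set Implicit Arguments.
Unset Strict Implicit.
Unset Printing Implicit Defensive.

Import Order.TTheory GRing.Theory Num.Theory.
Import numFieldNormedType.Exports.

Local Open Scope classical_set_scope.
Local Open Scope ring_scope.

(* MathComp-Analysis already equips a subset [A], seen as a type, with the
   induced pseudometric; this adds the induced distance, so that [A] is a
   metric space in its own right. *)
Section induced_metric.
Context {R : realType} {X : metricType R} (A : set X).

Definition induced_dist (x y : A) : R := mdist (set_val x) (set_val y).

Lemma induced_dist_ge0 x y : 0 <= induced_dist x y.
Proof. exact: mdist_ge0. Qed.

Lemma induced_dist_positivity x y : induced_dist x y = 0 -> x = y.
Proof. by move/mdist_positivity/val_inj. Qed.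

Lemma induced_ballE (x : A) (d : R) : ball x d = [set y | induced_dist x y < d].
Proof.
transitivity (@set_val _ A @^-1` ball (set_val x) d); first by [].
by rewrite ballEmdist.
Qed.

HB.instance Definition _ := @PseudoMetric_isMetric.Build R (set_type A)
  induced_dist induced_dist_ge0 induced_dist_positivity induced_ballE.

End induced_metric.

Section little_lipschitz.
Context {R : realType}.
Implicit Types X Y : metricType R.

Definition separable X := exists2 D : set X, countable D & dense D.

(* Unlike the library's [closed_ball], which is the closure of the open ball
   and can be strictly smaller. *)
Definition cball X (x : X) (r : R) : set X := [set y | mdist x y <= r].

(* The value on the empty set is -oo instead of 0; below, diameters are only
   taken of images of balls of positive radius, which are nonempty. *)
Definition diam X (A : set X) : \bar R :=
  ereal_sup [set z | exists x y, [/\ A x, A y & z = (mdist x y)%:E]].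

Definition lip X Y (f : X -> Y) (x : X) : \bar R :=
  limf_einf (fun r : R => diam (f @` cball x r) * (r^-1)%:E)%E (0^'+).

Definition little_lipschitz_on X Y (A : set X) (f : X -> Y) :=
  forall x, A x -> (lip f x < +oo)%E.

Definition little_lipschitz X Y (f : X -> Y) := little_lipschitz_on setT f.

Definition metric_lipschitz_on X Y (A : set X) (f : X -> Y) :=
  exists2 L : R, 0 <= L &
    forall x y, A x -> A y -> mdist (f x) (f y) <= L * mdist x y.

Definition locally_lipschitz_on X Y (A : set X) (f : X -> Y) :=
  forall x, A x -> exists2 U, nbhs x U & metric_lipschitz_on (U `&` A) f.

End little_lipschitz.

(* Main.v *)
Require Import Defs.
From HB Require Import structures.
From mathcomp Require Import all_boot all_order all_algebra.
From mathcomp Require Import all_classical all_reals all_analysis.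
From mathcomp Require Import lra ring.

Set Implicit Arguments.
Unset Strict Implicit.
Unset Printing Implicit Defensive.

Import Order.TTheory GRing.Theory Num.Theory.
Import numFieldNormedType.Exports.

Local Open Scope classical_set_scope.
Local Open Scope ring_scope.

(** Off [F] the extension is a weighted average of the values of [f], in which
    a point [p] of [F] counts for [x] only when [d x p < 2 * dist x F].  If
    [x0] lies in [F], such a [p] satisfies [d x0 p <= 3 * d x0 x], so the new
    values on the ball of radius [r / 3] about [x0] are averages of values of
    [f] on the ball of radius [r]: wherever [f] oscillates by at most [C * r]
    on the latter, so does the average on the former, up to a constant factor.
    Every radius that witnesses the finiteness of [lip f x0] therefore yields,
    divided by 3, one that witnesses it for the extension.

    The average used is a quotient of two suprema rather than of two sums.
    For [g >= 0] put [v_p x = max 0 (2 * dist x F - d x p) / (1 + g p)] and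
      [average x = sup_p (g p * v_p x) / sup_p (v_p x)].
    If [lo <= g p <= hi] whenever [v_p x > 0], the quotient lies in [[lo, hi]]
    too ([average_oscillation]), which is all that an average has to satisfy
    here.  The coefficients [g p / (1 + g p)] and [1 / (1 + g p)] of the bump
    are both in [[0, 1]], so both suprema are finite even if [g] is unbounded
    near [x], and they are suprema of 3-Lipschitz functions, hence Lipschitz on
    the whole of [X]; the quotient is then locally Lipschitz where the
    denominator is positive, i.e. off [F]
    ([average_locally_lipschitz]).  A function of arbitrary sign is handled as
    the difference of its positive and negative parts; their oscillations are
    at most that of [f], on the same balls, so no radius has to be changed. *)

(** * The lower scaled oscillation *)

(** A liminf along [0^'+] is finite as soon as the quotient stays bounded along
    some radii tending to 0, and oscillation about the center controls the
    diameter up to a factor 2.  This form has no extended reals left. *)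
Lemma lip_lty (R : realType) (X Y : metricType R) (f : X -> Y) (x : X) :
  (lip f x < +oo)%E <->
  exists C : R, forall e : R, 0 < e -> exists r,
    [/\ 0 < r, r < e &
        forall y, mdist x y <= r -> mdist (f x) (f y) <= C * r].
Proof.
rewrite /lip limf_einfE; split=> [lipfx|[C osc]].
- have [C lipC] : exists C : R, (ereal_sup [set ereal_inf
      ((fun r : R => diam (f @` cball x r) * r^-1%:E) @` V) |
      V in (0 : R)^'+] <= C%:E)%E.
    move: lipfx; set s := ereal_sup _; case: s => [s _|//|_].
    + by exists s.
    + by exists 0; exact: leNye.
  exists (C + 1) => e e0.
  have Ve : (0 : R)^'+ [set r : R | 0 < r < e].
    apply: filterS2 (nbhs_right_gt 0) (nbhs_right_lt e0) => r /= r0 re.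
    exact/andP.
  have : (ereal_inf
      ((fun r : R => diam (f @` cball x r) * r^-1%:E) @`
        [set r : R | 0 < r < e]%R) < (C + 1)%:E)%E.
    apply: (@le_lt_trans _ _ C%:E); last by rewrite lte_fin ltrDl.
    apply: le_trans lipC.
    by apply: ereal_sup_ubound; exists [set r : R | 0 < r < e].
  move=> /ereal_inf_lt[_ [r /= /andP[r0 re] <-] diamlt]; exists r; split => //.
  move=> y xy.
  rewrite -ler_pdivrMr// -lee_fin EFinM; apply: le_trans (ltW diamlt).
  rewrite lee_wpmul2r ?lee_fin ?invr_ge0 ?(ltW r0)//.
  apply: ereal_sup_ubound; exists (f x), (f y); split => //.
  by exists x => //; rewrite /cball/= mdistxx ltW.
- apply: (@le_lt_trans _ _ (2 * C)%:E); last exact: ltry.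
  apply: ge_ereal_sup => _ [V V0 <-].
  have [e /= e0 eV] := V0.
  have [r [r0 re oscr]] := osc _ e0.
  apply: ge_ereal_inf; exists (diam (f @` cball x r) * r^-1%:E)%E.
    exists r => //; apply: eV => //=.
    by rewrite sub0r normrN gtr0_norm.
  rewrite -(@mulfK _ r _ (2 * C)) ?gt_eqF// EFinM.
  rewrite lee_wpmul2r ?lee_fin ?invr_ge0 ?(ltW r0)//.
  apply: ge_ereal_sup => _ [_ [_ [[a xa <-] [b xb <-] ->]]].
  rewrite lee_fin.
  apply: (le_trans (metric_triangle _ (f x) _)).
  rewrite (metric_sym (f a)).
  by have := oscr _ xa; have := oscr _ xb; lra.
Qed.

(** * Lipschitz and locally Lipschitz real functions *)

Lemma mdistE (R : realType) (s t : R^o) : mdist s t = `|t - s|.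
Proof. by []. Qed.

Section locally_lipschitz_arithmetic.
Context (R : realType) (X : metricType R).

(** One-sided bounds are what passes to suprema, and they suffice because [a]
    and [b] can be exchanged. *)
Lemma metric_lipschitz_one_sided (A : set X) (L : R) (h : X -> R^o) : 0 <= L ->
  (forall a b, A a -> A b -> h a <= h b + L * mdist a b) ->
  metric_lipschitz_on A h.
Proof.
move=> L0 hL; exists L => // a b Aa Ab.
have := hL _ _ Aa Ab; have := hL _ _ Ab Aa.
rewrite mdistE (metric_sym b) => ? ?.
by rewrite ler_norml; apply/andP; split; lra.
Qed.

Lemma locally_lipschitz_onS (A B : set X) (h : X -> R^o) :
  A `<=` B -> locally_lipschitz_on B h -> locally_lipschitz_on A h.
Proof.
move=> AB hB x /AB /hB[U xU [L L0 UL]]; exists U => //; exists L => //.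
by move=> a b [Ua /AB Ba] [Ub /AB Bb]; exact: UL.
Qed.

Lemma locally_lipschitz_onB (A : set X) (h k : X -> R^o) :
  locally_lipschitz_on A h -> locally_lipschitz_on A k ->
  locally_lipschitz_on A (fun x => h x - k x : R^o).
Proof.
move=> hA kA x Ax; have [U xU [L L0 UL]] := hA x Ax.
have [V xV [M M0 VM]] := kA x Ax.
exists (U `&` V); first exact: filterI.
exists (L + M); first exact: addr_ge0.
move=> a b [[Ua Va] Aa] [[Ub Vb] Ab].
rewrite mdistE mulrDl.
have -> : h b - k b - (h a - k a) = (h b - h a) - (k b - k a) by ring.
apply: (le_trans (ler_normB _ _)); apply: lerD.
- exact: UL.
- exact: VM.
Qed.

(** Near a point where [v] is positive, it stays above half its value there,
    while [u] stays bounded; the usual identity for the difference of two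
    quotients does the rest. *)
Lemma locally_lipschitz_on_quotient (u v : X -> R^o) :
  metric_lipschitz_on setT u -> metric_lipschitz_on setT v ->
  locally_lipschitz_on [set x | 0 < v x] (fun x => u x / v x : R^o).
Proof.
move=> [K K0 uK] [L L0 vL] x /= vx0.
set m := v x / 2; have m0 : 0 < m by rewrite divr_gt0.
(* [L + 1] instead of [L] only because [L] may be 0. *)
set r := m / (L + 1); have r0 : 0 < r by rewrite divr_gt0// ltr_wpDl.
have Lr : L * r <= m.
  by rewrite /r mulrA ler_pdivrMr ?ltr_wpDl//; nra.
set M := `|u x| + K * r.
have M0 : 0 <= M by rewrite addr_ge0// mulr_ge0// ltW.
exists (ball x r); first exact: nbhsx_ballx.
have local a : ball x r a -> m <= v a /\ `|u a| <= M.
  rewrite ballEmdist/= => /ltW xa.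
  have := vL x a I I; have := uK x a I I.
  have Kr : K * mdist x a <= K * r by rewrite ler_wpM2l.
  have Lr' : L * mdist x a <= L * r by rewrite ler_wpM2l.
  rewrite !mdistE => ua va; split.
  + by move: va; rewrite ler_norml => /andP[va _]; rewrite /m in Lr *; lra.
  + have -> : u a = (u a - u x) + u x by rewrite subrK.
    by apply: (le_trans (ler_normD _ _)); rewrite addrC lerD2l; lra.
exists (K / m + M * L / m ^+ 2).
  by rewrite addr_ge0// ?mulr_ge0// ?invr_ge0 ?exprn_ge0 ?ltW.
move=> a b [/local[va ua] _] [/local[vb ub] _].
have va0 := lt_le_trans m0 va; have vb0 := lt_le_trans m0 vb.
rewrite mdistE.
have -> : u b / v b - u a / v a =
    (u b - u a) / v b - u a * (v b - v a) / (v b * v a).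
  by field; rewrite !gt_eqF.
apply: (le_trans (ler_normB _ _)); rewrite [leRHS]mulrDl lerD//.
- rewrite normrM normfV (gtr0_norm vb0) mulrAC.
  by rewrite ler_pM ?invr_ge0 ?(ltW vb0)// ?lef_pV2 ?posrE//; exact: uK.
- rewrite !normrM normfV normrM (gtr0_norm vb0) (gtr0_norm va0).
  rewrite [leRHS]mulrAC -[M * L * _]mulrA.
  rewrite ler_pM ?mulr_ge0 ?invr_ge0 ?mulr_ge0 ?(ltW va0) ?(ltW vb0)//.
  + rewrite ler_pM//; exact: vL.
  + by rewrite lef_pV2 ?posrE ?mulr_gt0 ?exprn_gt0// expr2 ler_pM// ltW.
Qed.

End locally_lipschitz_arithmetic.

(** * Averages with a Lipschitz quotient *)

Section averaging.
Context (R : realType) (X : metricType R) (I : Type) (c : I -> X) (i0 : I).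

Lemma lipschitz_sup (L : R) (h : I -> X -> R) :
  (forall i a b, h i a <= h i b + L * mdist a b) ->
  (forall x, has_ubound (range (h ^~ x))) ->
  forall a b, sup (range (h ^~ a)) <= sup (range (h ^~ b)) + L * mdist a b.
Proof.
move=> hL hub a b; apply: ge_sup; first by exists (h i0 a), i0.
move=> _ [i _ <-]; apply: le_trans (hL i a b) _; rewrite lerD2r.
by apply: ub_le_sup => //; exists i.
Qed.

(** The distance from [x] to the range of [c]. *)
Definition gap (x : X) : R := - sup (range (fun i => - mdist x (c i))).

Let gap_bounded x : has_ubound (range (fun i => - mdist x (c i))).
Proof. by exists 0 => _ [i _ <-]; rewrite oppr_le0 mdist_ge0. Qed.

Lemma gap_le x i : gap x <= mdist x (c i).
Proof. by rewrite lerNl; apply: ub_le_sup => //; exists i. Qed.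

Lemma le_gap x e : (forall i, e <= mdist x (c i)) -> e <= gap x.
Proof.
move=> ed; rewrite lerNr; apply: ge_sup; first by exists (- mdist x (c i0)), i0.
by move=> _ [i _ <-]; rewrite lerN2.
Qed.

Lemma gap_ge0 x : 0 <= gap x.
Proof. by apply: le_gap => i; exact: mdist_ge0. Qed.

Lemma gap_approx x : 0 < gap x -> exists i, mdist x (c i) < 2 * gap x.
Proof.
move=> x0; apply/not_existsP => far.
have : 2 * gap x <= gap x by apply: le_gap => i; rewrite leNgt; apply/negP.
by rewrite leNgt; apply/negP/negPn; rewrite mulr_natl mulr2n ltrDl.
Qed.

Lemma gap_lipschitz a b : gap a <= gap b + mdist a b.
Proof.
rewrite -lerBlDr; apply: le_gap => i; rewrite lerBlDr addrC.
by apply: le_trans (gap_le a i) _; exact: metric_triangle.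
Qed.

(** The factor 2 makes some bump positive wherever [gap] is, even when the
    distance to the range of [c] is not attained. *)
Definition bump (i : I) (x : X) : R := Num.max 0 (2 * gap x - mdist x (c i)).

Lemma bump_ge0 i x : 0 <= bump i x.
Proof. by rewrite le_max lexx. Qed.

Lemma bump_le i x : bump i x <= 2 * gap x.
Proof.
by rewrite ge_max mulr_ge0 ?gap_ge0//= gerDl oppr_le0 mdist_ge0.
Qed.

Lemma bump_lipschitz i a b : bump i a <= bump i b + 3 * mdist a b.
Proof.
have ? := gap_lipschitz a b.
have := metric_triangle b a (c i); rewrite (metric_sym b a) => ?.
have ? := bump_ge0 i b; have ? := mdist_ge0 a b.
have : 2 * gap b - mdist b (c i) <= bump i b by rewrite le_max lexx orbT.
by rewrite {2}/bump ge_max => ?; apply/andP; split; lra.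
Qed.

Definition bump_sup (k : I -> R) (x : X) : R :=
  sup (range (fun i => k i * bump i x)).

Section bump_sup.
Variable k : I -> R.
Hypothesis k01 : forall i, 0 <= k i <= 1.

Let bounded x : has_ubound (range (fun i => k i * bump i x)).
Proof.
exists (2 * gap x) => _ [i _ <-]; have /andP[k0 k1] := k01 i.
by apply: le_trans (bump_le i x); rewrite ler_piMl// bump_ge0.
Qed.

Lemma bump_sup_ge i x : k i * bump i x <= bump_sup k x.
Proof. by apply: ub_le_sup => //; exists i. Qed.

Lemma bump_sup_ge0 x : 0 <= bump_sup k x.
Proof.
apply: le_trans (bump_sup_ge i0 x); have /andP[k0 _] := k01 i0.
by rewrite mulr_ge0 ?bump_ge0.
Qed.

(** Factors in [[0, 1]] keep the functions [k i * bump i] uniformly bounded at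
    each point and uniformly 3-Lipschitz. *)
Lemma bump_sup_lipschitz : metric_lipschitz_on setT (bump_sup k : X -> R^o).
Proof.
apply: (@metric_lipschitz_one_sided _ _ _ 3) => // a b _ _.
apply: (lipschitz_sup (h := fun i x => k i * bump i x)) => // i a' b'.
have /andP[k0 k1] := k01 i; have := bump_lipschitz i a' b'.
by have := mdist_ge0 a' b'; nra.
Qed.

Lemma bump_sup_gt0 x : 0 < gap x -> (forall i, 0 < k i) -> 0 < bump_sup k x.
Proof.
move=> x0 kp; have [i xi] := gap_approx x0.
apply: lt_le_trans (bump_sup_ge i x).
by rewrite mulr_gt0// lt_max subr_gt0 xi orbT.
Qed.

End bump_sup.

Variable g : I -> R.
Hypothesis g0 : forall i, 0 <= g i.

Definition average_num : X -> R := bump_sup (fun i => g i / (1 + g i)).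
Definition average_den : X -> R := bump_sup (fun i => (1 + g i)^-1).
Definition average (x : X) : R^o := average_num x / average_den x.

Let g1 i : 0 < 1 + g i. Proof. by rewrite ltr_wpDr. Qed.

Let num01 i : 0 <= g i / (1 + g i) <= 1.
Proof.
by rewrite divr_ge0 ?(ltW (g1 i))//= ler_pdivrMr// mul1r lerDr.
Qed.

Let den01 i : 0 <= (1 + g i)^-1 <= 1.
Proof. by rewrite invr_ge0 ltW//= invf_le1// lerDl. Qed.

Lemma average_locally_lipschitz :
  locally_lipschitz_on [set x | 0 < gap x] average.
Proof.
apply: (@locally_lipschitz_onS _ _ _ [set x | 0 < average_den x]).
- by move=> x x0; apply: bump_sup_gt0 => // i; rewrite invr_gt0.
- exact: (locally_lipschitz_on_quotient (u := average_num) (v := average_den)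
    (bump_sup_lipschitz num01) (bump_sup_lipschitz den01)).
Qed.

(** Each term of the numerator lies between [g i - e] and [g i + e] times the
    corresponding term of the denominator: where the bump vanishes
    this is trivial, and elsewhere [c j] is within [2 * gap x] of [x], hence
    within [3 * mdist (c i) x] of [c i].  These bounds survive the suprema. *)
Lemma average_oscillation x i e : 0 < gap x ->
  (forall j, mdist (c i) (c j) <= 3 * mdist (c i) x -> `|g j - g i| <= e) ->
  `|average x - g i| <= e.
Proof.
move=> x0 osc.
have den0 : 0 < average_den x by apply: bump_sup_gt0 => // j; rewrite invr_gt0.
set v := fun j => (1 + g j)^-1 * bump j x.
have numE j : g j / (1 + g j) * bump j x = g j * v j by rewrite -mulrA.
have weighted j : (g i - e) * v j <= g j * v j <= (g i + e) * v j.
  have [bj|bj] := leP (bump j x) 0.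
    have bj0 : bump j x = 0 by apply/eqP; rewrite eq_le bj bump_ge0.
    by rewrite /v bj0 !mulr0 lexx.
  have : `|g j - g i| <= e.
    move: bj; rewrite lt_max ltxx/= subr_gt0 => xj; apply: osc.
    have := gap_le x i; rewrite (metric_sym x) => ?.
    by have := metric_triangle (c i) x (c j); lra.
  rewrite ler_distl => /andP[lo hi].
  have v0 : 0 <= v j by rewrite mulr_ge0 ?invr_ge0 ?bump_ge0 ?(ltW (g1 j)).
  by rewrite !ler_wpM2r.
rewrite ler_distl; apply/andP; split.
- rewrite /average ler_pdivlMr//.
  (* Only a positive factor can be moved inside the supremum; for
     [g i - e <= 0] it is enough that the average is nonnegative. *)
  have [neg|pos] := leP (g i - e) 0.
    apply: (@le_trans _ _ 0); last exact: bump_sup_ge0.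
    by rewrite mulr_le0_ge0// ltW.
  rewrite mulrC -ler_pdivlMr//; apply: ge_sup; first by eexists; exists i0.
  move=> _ [j _ <-]; rewrite ler_pdivlMr// mulrC.
  have /andP[lo _] := weighted j; apply: (le_trans lo).
  by rewrite -numE; exact: bump_sup_ge.
- rewrite /average ler_pdivrMr//; apply: ge_sup; first by eexists; exists i0.
  move=> _ [j _ <-]; rewrite numE.
  have e0 : 0 <= e.
    apply: le_trans (osc i _); first exact: normr_ge0.
    by rewrite mdistxx mulr_ge0// mdist_ge0.
  have /andP[_ hi] := weighted j; apply: (le_trans hi).
  by rewrite ler_wpM2l ?addr_ge0//; exact: bump_sup_ge.
Qed.

End averaging.

(** * The extension *)

Lemma locally_lipschitz_lip_lty (R : realType) (X Y : metricType R)
    (A : set X) (f : X -> Y) (x : X) :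
  open A -> locally_lipschitz_on A f -> A x -> (lip f x < +oo)%E.
Proof.
move=> oA fA Ax; have [U xU [L L0 UL]] := fA x Ax; apply/lip_lty.
have /nbhs_ballP[d /= d0 dUA] : nbhs x (U `&` A).
  by apply: filterI => //; exact: open_nbhs_nbhs.
exists L => e e0; exists (Num.min d e / 2).
have de0 : 0 < Num.min d e by rewrite lt_min d0.
have de2 : Num.min d e / 2 < Num.min d e.
  by rewrite ltr_pdivrMr// ltr_pMr// ltr1n.
split; [by rewrite divr_gt0 | by move: de2; rewrite !lt_min => /andP[] |].
move=> y xy; apply: le_trans (ler_wpM2l L0 xy).
apply: UL; apply: dUA; first exact: ballxx.
rewrite ballEmdist/=; apply: le_lt_trans xy _.
by move: de2; rewrite !lt_min => /andP[].
Qed.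

Lemma gap_gt0 (R : realType) (X : metricType R) (F : set X) (i0 : F) (x : X) :
  closed F -> ~ F x -> 0 < gap (@set_val X F) x.
Proof.
move=> /closed_openC oF Fx.
have /nbhs_ballP[d /= d0 dF] : nbhs x (~` F) by apply: open_nbhs_nbhs.
apply: (lt_le_trans d0); apply: le_gap => // i; rewrite leNgt; apply/negP => xi.
by apply: (dF (set_val i)); [rewrite ballEmdist | exact: set_valP].
Qed.

Lemma ler_dist_max0 (R : realDomainType) (s t : R) :
  `|Num.max 0 s - Num.max 0 t| <= `|s - t|.
Proof.
have := ler_norm (s - t); have := ler_norm (t - s); rewrite (distrC t) => ? ?.
by case: (leP 0 s) => ?; case: (leP 0 t) => ?; rewrite ler_norml;
  apply/andP; split; lra.
Qed.

(** The function [h] used off [F].  The factor 2 counts the positive and the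
    negative part of [f]. *)
Lemma exists_oscillation_bounded (R : realType) (X : metricType R) (F : set X)
    (f : F -> R) : closed F ->
  exists2 h : X -> R^o, locally_lipschitz_on (~` F) h &
    forall x (p : F) e, ~ F x ->
      (forall q : F, mdist p q <= 3 * mdist (set_val p) x ->
        `|f q - f p| <= e) ->
      `|h x - f p| <= 2 * e.
Proof.
move=> closedF; have [[p0 _]|noF] := pselect (exists p : F, True); last first.
  exists (fun=> 0); last by move=> x p; case: noF; exists p.
  move=> x _; exists setT; first exact: filterT.
  by exists 0 => // a b _ _; rewrite mdistxx mul0r.
pose pos p := Num.max 0 (f p); pose neg p := Num.max 0 (- f p).
have pos0 p : 0 <= pos p by rewrite le_max lexx.
have neg0 p : 0 <= neg p by rewrite le_max lexx.
have outside : ~` F `<=` [set x | 0 < gap (@set_val X F) x].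
  by move=> x; exact: gap_gt0.
exists (fun x => average set_val pos x - average set_val neg x).
  by apply: locally_lipschitz_onB; apply: locally_lipschitz_onS outside _;
    exact: average_locally_lipschitz.
move=> x p e Fx osc.
have -> : f p = pos p - neg p.
  by rewrite /pos /neg; case: (leP 0 (f p)) => ?;
    case: (leP 0 (- f p)) => ?; lra.
rewrite opprD addrACA -opprD mulr2n mulrDl mul1r.
apply: (le_trans (ler_normB _ _)); apply: lerD.
- apply: average_oscillation => //; first exact: outside.
  by move=> q /osc; apply: le_trans; exact: ler_dist_max0.
- apply: average_oscillation => //; first exact: outside.
  move=> q /osc; apply: le_trans; apply: (le_trans (ler_dist_max0 _ _)).
  by rewrite -opprD normrN.
Qed.

Theorem theorem4p2 (R : realType) (X : metricType R) (sepX : separable X)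
    (F : set X) (closedF : closed F) (f : F -> R^o)
    (lipf : little_lipschitz f) :
  exists fstar : X -> R^o,
    [/\ forall x : F, fstar (set_val x) = f x,
        little_lipschitz_on F fstar,
        locally_lipschitz_on (~` F) fstar &
        little_lipschitz fstar].
Proof.
have [h hlip hosc] := exists_oscillation_bounded f closedF.
pose fstar x : R^o := if insub x is Some p then f p else h x.
have fstarF (p : F) : fstar (set_val p) = f p by rewrite /fstar set_valE valK.
have fstarC x : ~ F x -> fstar x = h x.
  by move=> Fx; rewrite /fstar insubN//; apply/negP => /set_mem.
have point x : F x -> exists p : F, set_val p = x.
  by move=> Fx; exists (SigSub (mem_set Fx)).
have onC : locally_lipschitz_on (~` F) fstar.
  move=> x /hlip[U xU [L L0 UL]]; exists U => //; exists L => //.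
  move=> a b [Ua Fa] [Ub Fb].
  by rewrite !fstarC//; exact: UL.
have onF : little_lipschitz_on F fstar.
  move=> _ /point[p <-]; apply/lip_lty.
  have [C osc] := (lip_lty f p).1 (lipf p I).
  (* On the ball of radius [r / 3] the values differ from that at [p] by at most
     [2 * (C * r) = 6 * C * (r / 3)]. *)
  exists (6 * C) => e e0; have [r [r0 re oscr]] := osc _ e0.
  have Cr0 : 0 <= C * r
    by apply: le_trans (oscr p _); [exact: mdist_ge0 | rewrite mdistxx ltW].
  exists (r / 3); split; [lra | lra | move=> y py].
  have [/point[q yq]|Fy] := pselect (F y).
    rewrite -yq in py *; rewrite !fstarF.
    apply: (@le_trans _ _ (C * r)); last by lra.
    by apply: oscr; apply: le_trans py _; lra.
  rewrite fstarF fstarC// mdistE.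
  apply: (@le_trans _ _ (2 * (C * r))); last by lra.
  apply: hosc => // q pq; rewrite -mdistE; apply: oscr.
  by apply: le_trans pq _; lra.
exists fstar; split => // x _; have [Fx|Fx] := pselect (F x).
- exact: onF.
- by apply: (locally_lipschitz_lip_lty _ onC) => //; exact: closed_openC.
Qed.
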